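(* Fix an imprecise probabilities tree with finite state space $\mathscr{X}$, and let $\overline{\mathrm{E}}_{\mathrm V}$ be the corresponding game-theoretic upper expectation. For any $f\colon\Omega\to\overline{\mathbb{R}}$ and any situation $s\in\mathscr{X}^{\ast}$, \[\overline{\mathrm{E}}_{\mathrm V}(f\vert s)=\inf\big\{\overline{\mathrm{E}}_{\mathrm V}(g\vert s): g\in\overline{\mathbb{V}}_{b,\mathrm{lim}}\text{ and }g\ge_s f\big\}=\inf\big\{\overline{\mathrm{E}}_{\mathrm V}(g\vert s): g\in\overline{\mathbb{V}}_{b,\mathrm{lim}}\text{ and }g\ge f\big\}.\]
   Context: Notation: $\mathbb{N}=\{1,2,\dots\}$, $\mathbb{N}_0=\mathbb{N}\cup\{0\}$, $\overline{\mathbb{R}}=\mathbb{R}\cup\{-\infty,+\infty\}$, with conventions $+\infty-\infty=-\infty+\infty=+\infty$, $0\cdot(\pm\infty)=0$, $\inf\emptyset=+\infty$. For a non-empty set $\mathscr{Y}$, $\overline{\mathscr{L}}(\mathscr{Y})$ is the set of all maps $\mathscr{Y}\to\overline{\mathbb{R}}$ and $\overline{\mathscr{L}}_b(\mathscr{Y})$ the subset of those bounded below by a real constant. Limits and inequalities of functions are pointwise. Local models: $\mathscr{X}$ is a finite non-empty set. $\mathscr{X}^{\ast}=\bigcup_{n\in\mathbb{N}_0}\mathscr{X}^n$ is the set of situations (finite strings, including the empty string $\Box$). An imprecise probabilities tree assigns to each $s\in\mathscr{X}^{\ast}$ a map $\overline{\mathrm{Q}}_s\colon\overline{\mathscr{L}}(\mathscr{X})\to\overline{\mathbb{R}}$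 that is an upper expectation, i.e. satisfies: (E1) $\overline{\mathrm{Q}}_s(c)=c$ for all $c\in\mathbb{R}$; (E2) $\overline{\mathrm{Q}}_s(f+g)\le\overline{\mathrm{Q}}_s(f)+\overline{\mathrm{Q}}_s(g)$ for all $f,g\in\overline{\mathscr{L}}_b(\mathscr{X})$; (E3) $\overline{\mathrm{Q}}_s(\lambda f)=\lambda\overline{\mathrm{Q}}_s(f)$ for all real $\lambda>0$ and $f\in\overline{\mathscr{L}}_b(\mathscr{X})$; (E4) $f\le g\Rightarrow\overline{\mathrm{Q}}_s(f)\le\overline{\mathrm{Q}}_s(g)$ for all $f,g\in\overline{\mathscr{L}}_b(\mathscr{X})$; (E5) $\lim_n\overline{\mathrm{Q}}_s(f_n)=\overline{\mathrm{Q}}_s(\lim_n f_n)$ for every non-decreasing sequence $\{f_n\}_{n\in\mathbb{N}_0}$ of non-negative variables in $\overline{\mathscr{L}}_b(\mathscr{X})$. Global model: $\Omega=\mathscr{X}^{\mathbb{N}}$ is the set of paths; for $\omega\in\Omega$, $\omega^n\in\mathscr{X}^n$ is the string of its first $n$ values; $\Gamma(x_{1:n})=\{\omega\in\Omega:\omega^n=x_{1:n}\}$. For $g,h\colon\Omega\to\overline{\mathbb{R}}$, $g\ge_s h$ means $g(\omega)\ge h(\omega)$ for all $\omega\in\Gamma(s)$. A supermartingale is a map $\mathscr{M}\colon\mathscr{X}^{\ast}\to\overline{\mathbb{R}}$ with $\overline{\mathrm{Q}}_s(\mathscr{M}(s\,\cdot))\le\mathscr{M}(s)$ for all $s\in\mathscr{X}^{\ast}$,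 where $\mathscr{M}(s\,\cdot)\in\overline{\mathscr{L}}(\mathscr{X})$ is $x\mapsto\mathscr{M}(sx)$. $\overline{\mathbb{M}}_{\mathrm b}$ is the set of supermartingales bounded below by a real constant, and $\liminf\mathscr{M}(\omega)=\liminf_{n\to+\infty}\mathscr{M}(\omega^n)$. The game-theoretic upper expectation is, for all $f\colon\Omega\to\overline{\mathbb{R}}$ and $s\in\mathscr{X}^{\ast}$, \[\overline{\mathrm{E}}_{\mathrm V}(f\vert s)=\inf\{\mathscr{M}(s):\mathscr{M}\in\overline{\mathbb{M}}_{\mathrm b},\ \liminf\mathscr{M}\ge_s f\}.\] A variable $f\colon\Omega\to\overline{\mathbb{R}}$ is $n$-measurable if $f(\omega)$ depends only on $\omega^n$, and finitary if it is $n$-measurable for some $n\in\mathbb{N}_0$. $\overline{\mathbb{V}}_{b,\mathrm{lim}}$ is the set of all bounded below $f\colon\Omega\to\overline{\mathbb{R}}$ such that $f=\lim_{n\to+\infty}f_n$ pointwise for some sequence $\{f_n\}_{n\in\mathbb{N}_0}$ of finitary extended real variables. *)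

(* Defs.v *)
From mathcomp Require Import all_boot all_order all_algebra.
From mathcomp Require Import all_classical all_reals all_analysis.
Import Order.TTheory GRing.Theory Num.Theory.
Import numFieldNormedType.Exports.

Set Implicit Arguments.
Unset Strict Implicit.
Unset Printing Implicit Defensive.

Local Open Scope classical_set_scope.
Local Open Scope ring_scope.
Local Open Scope ereal_scope.

Definition bounded_below (R : realType) (T : Type) (f : T -> \bar R) : Prop :=
  exists c : R, forall t, c%:E <= f t.

(* Sums use the addition of \bar R in which +oo - oo = +oo, written %dE (the
   default one has +oo - oo = -oo). Q is defined on all maps X -> \bar R, but
   only its values on bounded-below maps are constrained. *)
Record upper_expectation (R : realType) (X : Type)
    (Q : (X -> \bar R) -> \bar R) : Prop := UpperExpectation {
  upper_expectation_cst : forall c : R, Q (cst c%:E) = c%:E ;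
  upper_expectation_subadd : forall f g : X -> \bar R,
    bounded_below f -> bounded_below g ->
    Q (fun x => (f x + g x)%dE) <= (Q f + Q g)%dE ;
  upper_expectation_scale : forall (lambda : R) (f : X -> \bar R),
    (0 < lambda)%R -> bounded_below f ->
    Q (fun x => lambda%:E * f x) = lambda%:E * Q f ;
  upper_expectation_mono : forall f g : X -> \bar R,
    bounded_below f -> bounded_below g ->
    (forall x, f x <= g x) -> Q f <= Q g ;
  upper_expectation_cvg : forall f : nat -> X -> \bar R,
    (forall n, bounded_below (f n)) ->
    (forall n x, 0 <= f n x) ->
    (forall n x, f n x <= f n.+1 x) ->
    Q (f n) @[n --> \oo] --> Q (fun x => limn (fun n => f n x))
}.

(* Situations are finite sequences over X, the empty sequence included. *)
Definition imprecise_tree (R : realType) (X : finType)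
    (Q : seq X -> (X -> \bar R) -> \bar R) : Prop :=
  forall s, upper_expectation (Q s).

(* A path w : nat -> X is indexed from 0, so that its first n values are
   w 0, ..., w n.-1. *)
Definition path_prefix (X : Type) (w : nat -> X) (n : nat) : seq X := mkseq w n.

Definition cylinder (X : Type) (s : seq X) : set (nat -> X) :=
  [set w | path_prefix w (size s) = s].

Definition ge_at (R : realType) (X : Type) (s : seq X)
    (g h : (nat -> X) -> \bar R) : Prop :=
  forall w, cylinder s w -> h w <= g w.

Definition supermartingale (R : realType) (X : Type)
    (Q : seq X -> (X -> \bar R) -> \bar R) (M : seq X -> \bar R) : Prop :=
  forall s, Q s (fun x => M (rcons s x)) <= M s.

Definition liminf_path (R : realType) (X : Type) (M : seq X -> \bar R)
    (w : nat -> X) : \bar R :=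
  limn_einf (fun n => M (path_prefix w n)).

(* The infimum in \bar R of the empty set is +oo. *)
Definition game_upper_expectation (R : realType) (X : Type)
    (Q : seq X -> (X -> \bar R) -> \bar R)
    (f : (nat -> X) -> \bar R) (s : seq X) : \bar R :=
  ereal_inf [set M s | M in [set M : seq X -> \bar R |
    [/\ supermartingale Q M, bounded_below M & ge_at s (liminf_path M) f]]].

Definition n_measurable (R : realType) (X : Type) (n : nat)
    (f : (nat -> X) -> \bar R) : Prop :=
  forall w w', path_prefix w n = path_prefix w' n -> f w = f w'.

Definition finitary (R : realType) (X : Type)
    (f : (nat -> X) -> \bar R) : Prop :=
  exists n, n_measurable n f.

Definition lim_finitary_bb (R : realType) (X : Type) :
    set ((nat -> X) -> \bar R) :=
  [set f | bounded_below f /\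
    exists2 F : nat -> (nat -> X) -> \bar R,
      forall n, finitary (F n) & forall w, F n w @[n --> \oo] --> f w].

(* Main.v *)
(* A supermartingale M witnessing an upper bound for E(f|s) need not converge,
   so its lower limit need not be a limit of finitary variables. After a shift,
   M >= 0. For every pair of rationals a, e >= 0 the strategy that buys M when
   it is at most a and sells it when it is at least a + e has a nonnegative
   capital, dominating e times the number of completed upcrossings. Adding to M
   a weighted sum of these capitals, worth at most eps at s, gives a
   supermartingale M'. Adding instead the weighted upcrossing counts gives a
   process G with M <= G <= M' that converges along every path: the counts are
   nondecreasing in time, and some count tends to +oo when M oscillates. The
   limit of G, replaced by +oo outside the cylinder of s, is the required g. *)
Require Import Defs.
From mathcomp Require Import all_boot all_order all_algebra.
From mathcomp Require Import all_classical all_reals all_analysis.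
Import Order.TTheory GRing.Theory Num.Theory.

Local Open Scope classical_set_scope.
Local Open Scope ereal_scope.

(** * Upper expectations: finite and countable subadditivity *)

Lemma ge0_bounded_below {R : realType} {T : Type} (f : T -> \bar R) :
  (forall t, 0 <= f t) -> bounded_below f.
Proof. by move=> f0; exists 0%R. Qed.

Section UpperExpectation.
Context {R : realType} {X : Type} {Q : (X -> \bar R) -> \bar R}.
Context (QE : upper_expectation Q).

Lemma upper_expectation_ge0 (f : X -> \bar R) : (forall x, 0 <= f x) -> 0 <= Q f.
Proof.
move=> f0; rewrite [leLHS](_ : _ = Q (cst 0%:E)); last by rewrite (upper_expectation_cst QE).
by apply: (upper_expectation_mono QE) => //; apply: ge0_bounded_below.
Qed.

(** On nonnegative maps the two additions of [\bar R] agree, so subadditivity passes to the default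
    one. *)
Lemma ge0_upper_expectationD (f g : X -> \bar R) :
  (forall x, 0 <= f x) -> (forall x, 0 <= g x) ->
  Q (fun x => f x + g x) <= Q f + Q g.
Proof.
move=> f0 g0.
have := upper_expectation_subadd QE (ge0_bounded_below f f0) (ge0_bounded_below g g0).
rewrite (DualAddTheoryNumDomain.dual_addeE_def (ge0_adde_def _ _)); first last.
- by rewrite inE; apply: upper_expectation_ge0.
- by rewrite inE; apply: upper_expectation_ge0.
congr (_ <= _); congr (Q _); apply: funext => x.
by rewrite DualAddTheoryNumDomain.dual_addeE_def// ge0_adde_def// inE.
Qed.

Lemma upper_expectationD_cst (c : R) (f : X -> \bar R) :
  bounded_below f -> Q (fun x => c%:E + f x) <= c%:E + Q f.
Proof.
move=> bf; have bc : bounded_below (@cst X _ c%:E) by exists c.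
have := upper_expectation_subadd QE bc bf.
by rewrite (upper_expectation_cst QE c).
Qed.

Lemma upper_expectation_sum (f : nat -> X -> \bar R) n :
  (forall i x, 0 <= f i x) ->
  Q (fun x => \sum_(0 <= i < n) f i x) <= \sum_(0 <= i < n) Q (f i).
Proof.
move=> f0; elim: n => [|n IH].
  rewrite big_nil (_ : (fun x => _) = cst 0%:E); last first.
    by apply: funext => x; rewrite big_nil.
  by rewrite (upper_expectation_cst QE).
rewrite big_nat_recr//= (_ : (fun x => _) =
    (fun x => \sum_(0 <= i < n) f i x + f n x)); last first.
  by apply: funext => x; rewrite big_nat_recr.
apply: (le_trans (ge0_upper_expectationD _ _ _ _)) => //.
  by move=> x; apply: sume_ge0.
exact: leeD.
Qed.

(** Continuity along the nondecreasing partial sums extends finite subadditivity to series. *)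
Lemma upper_expectation_nneseries (f : nat -> X -> \bar R) :
  (forall i x, 0 <= f i x) ->
  Q (fun x => \sum_(i <oo) f i x) <= \sum_(i <oo) Q (f i).
Proof.
move=> f0; pose F n x := \sum_(0 <= i < n) f i x.
have F0 n x : 0 <= F n x by apply: sume_ge0.
have Fmono n x : F n x <= F n.+1 x by rewrite /F big_nat_recr//= leeDl.
have FQ := upper_expectation_cvg QE (fun n => ge0_bounded_below _ (F0 n)) F0 Fmono.
rewrite -(cvg_lim _ FQ)//; apply: lime_le; first by apply/cvg_ex; eexists; exact: FQ.
apply: nearW => n; apply: (le_trans (upper_expectation_sum _ _ _)) => //.
by apply: nneseries_lim_ge => i _ _; apply: upper_expectation_ge0.
Qed.

End UpperExpectation.

(** * Sums and shifts of supermartingales *)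

Section Supermartingales.
Context {R : realType} {X : Type} {Q : seq X -> (X -> \bar R) -> \bar R}.
Context (Q_tree : forall s, upper_expectation (Q s)).

Lemma supermartingaleD (M N : seq X -> \bar R) :
  (forall s, 0 <= M s) -> (forall s, 0 <= N s) ->
  supermartingale Q M -> supermartingale Q N ->
  supermartingale Q (fun s => M s + N s).
Proof.
move=> M0 N0 MQ NQ s.
apply: (le_trans (ge0_upper_expectationD (Q_tree s) _ _ _ _)) => //.
exact: leeD.
Qed.

Lemma supermartingaleD_cst (c : R) (M : seq X -> \bar R) :
  bounded_below M -> supermartingale Q M ->
  supermartingale Q (fun s => c%:E + M s).
Proof.
move=> [b bM] MQ s.
apply: (le_trans (upper_expectationD_cst (Q_tree s) _ _ _)); first by exists b.
by rewrite leeD2lE.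
Qed.

Lemma supermartingale_nneseries (d : nat -> R) (M : nat -> seq X -> \bar R) :
  (forall i, 0 < d i)%R -> (forall i s, 0 <= M i s) ->
  (forall i, supermartingale Q (M i)) ->
  supermartingale Q (fun s => \sum_(i <oo) (d i)%:E * M i s).
Proof.
move=> d0 M0 MQ s.
have dM0 i t : 0 <= (d i)%:E * M i t by rewrite mule_ge0// lee_fin ltW.
apply: (le_trans (upper_expectation_nneseries (Q_tree s) _ _)) => //.
apply: lee_nneseries => i *; first exact: upper_expectation_ge0.
rewrite (upper_expectation_scale (Q_tree s)) //; last first.
  exact: ge0_bounded_below.
by apply: lee_wpmul2l; [rewrite lee_fin ltW|exact: MQ].
Qed.

End Supermartingales.

(** * Upcrossings and the capital of the trading strategy *)

(* The count p increases both at a purchase and at a sale: p is odd while M is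
   held, and p./2 upcrossings have been completed. *)
Definition crossing_step {R : realType} (a e : R) (p : nat) (v : \bar R) : nat :=
  (p + (if odd p then ((a + e)%R%:E <= v)%E else (v <= a%:E)%E))%N.

(* The argument r is a situation read backwards, its last state first. *)
Fixpoint crossings_rev {R : realType} {X : Type} (a e : R)
    (M : seq X -> \bar R) (r : seq X) : nat :=
  if r is _ :: r' then crossing_step a e (crossings_rev a e M r') (M (rev r))
  else 0%N.

Definition crossings {R : realType} {X : Type} (a e : R)
    (M : seq X -> \bar R) (s : seq X) : nat := crossings_rev a e M (rev s).

(** The trader owns one unit of [M] or cash [a], and has put [e] aside per completed upcrossing. Any
    surplus from buying below [a] or selling above [a + e] is discarded. *)
Definition crossing_capital {R : realType} {X : Type} (a e : R)
    (M : seq X -> \bar R) (s : seq X) : \bar R :=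
  (e *+ (crossings a e M s)./2)%:E +
  (if odd (crossings a e M s) then M s else a%:E).

Section Crossings.
Context {R : realType} {X : Type} (a e : R) (M : seq X -> \bar R).

Lemma crossings_rcons s x : crossings a e M (rcons s x) =
  crossing_step a e (crossings a e M s) (M (rcons s x)).
Proof. by rewrite /crossings rev_rcons /= rev_cons revK. Qed.

Context (a0 : (0 <= a)%R) (e0 : (0 <= e)%R) (M0 : forall s, 0 <= M s).

Lemma crossing_capital_ge s :
  (e *+ (crossings a e M s)./2)%:E <= crossing_capital a e M s.
Proof. by rewrite /crossing_capital leeDl//; case: ifP. Qed.

Lemma crossing_capital_ge0 s : 0 <= crossing_capital a e M s.
Proof. by apply: le_trans (crossing_capital_ge s); rewrite lee_fin mulrn_wge0. Qed.

(** [M] may take the value [+oo], but not while held: it is at most [a] when just bought, and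
    reaching [a + e] ends the holding. *)
Lemma crossing_capital_fin_num s : crossing_capital a e M s \is a fin_num.
Proof.
rewrite /crossing_capital fin_numD /=; case: ifP => //.
case/lastP: s => [//|s x]; rewrite crossings_rcons /crossing_step oddD.
case: ifP => op; first case: leP => //= h _.
  by rewrite ge0_fin_numE//; apply: lt_trans h _; rewrite ltry.
case: leP => //= h _.
by rewrite ge0_fin_numE//; apply: le_lt_trans h _; rewrite ltry.
Qed.

(** The right side revalues after [x] the position taken at [s]. The two sides differ only by the
    surplus discarded in a purchase or a sale. *)
Lemma crossing_capital_rcons s x :
  crossing_capital a e M (rcons s x) <= (e *+ (crossings a e M s)./2)%:E +
    (if odd (crossings a e M s) then M (rcons s x) else a%:E).
Proof.
rewrite /crossing_capital crossings_rcons /crossing_step.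
set p := crossings a e M s; case: ifP => op.
  case: (leP (a + e)%R%:E) => h; rewrite ?addn0 ?op//=.
  rewrite addn1 /= op /= uphalfE /= uphalf_half op add1n mulrS.
  rewrite [leRHS]addeC EFinD -addeA addeC -addeA [X in X <= _]addeC.
  by rewrite leeD2r// addeC -EFinD.
by case: (leP _ a%:E) => h; rewrite ?addn0 ?addn1 /= op //= uphalf_half op add0n leeD2l.
Qed.

(** The position is fixed at [s], before the next state is known, so only [M] or a constant has to
    be averaged. *)
Lemma crossing_capital_supermartingale (Q : seq X -> (X -> \bar R) -> \bar R) :
  (forall s, upper_expectation (Q s)) ->
  supermartingale Q M -> supermartingale Q (crossing_capital a e M).
Proof.
move=> Q_tree MQ s; set p := crossings a e M s.
pose f x := if odd p then M (rcons s x) else a%:E.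
have f0 x : 0 <= f x by rewrite /f; case: ifP.
apply: (@le_trans _ _ (Q s (fun x => (e *+ p./2)%:E + f x))).
  apply: (upper_expectation_mono (Q_tree s)).
  - by apply: ge0_bounded_below => x; exact: crossing_capital_ge0.
  - by apply: ge0_bounded_below => x; rewrite adde_ge0// lee_fin mulrn_wge0.
  - by move=> x; exact: crossing_capital_rcons.
apply: (le_trans (upper_expectationD_cst (Q_tree s) _ _ _)).
  exact: ge0_bounded_below.
rewrite /crossing_capital -/p leeD2l// /f.
by case: (odd p); [exact: MQ|rewrite (upper_expectation_cst (Q_tree s))].
Qed.

Lemma crossings_prefixS w n : crossings a e M (path_prefix w n.+1) =
  crossing_step a e (crossings a e M (path_prefix w n))
    (M (path_prefix w n.+1)).
Proof. by rewrite /path_prefix mkseqS crossings_rcons. Qed.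

Lemma crossings_nondecreasing w :
  {homo (fun n => crossings a e M (path_prefix w n)) : m n / (m <= n)%N}.
Proof.
apply: homo_leq => [//||n]; first by move=> ? ? ?; exact: leq_trans.
by rewrite crossings_prefixS leq_addr.
Qed.

Lemma crossings_unbounded w :
  (forall n, exists2 m, (n < m)%N & M (path_prefix w m) <= a%:E) ->
  (forall n, exists2 m, (n < m)%N & (a + e)%R%:E <= M (path_prefix w m)) ->
  forall k, exists n, (k <= crossings a e M (path_prefix w n))%N.
Proof.
move=> Mlow Mhigh; elim=> [|k [n]]; first by exists 0%N.
rewrite leq_eqVlt => /orP[/eqP kE|]; last by exists n.
have [m nm hm] : exists2 m, (n <= m)%N &
    if odd k then (a + e)%R%:E <= M (path_prefix w m.+1)
    else M (path_prefix w m.+1) <= a%:E.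
  case: (odd k); first by have [[//|m] nm hm] := Mhigh n; exists m.
  by have [[//|m] nm hm] := Mlow n; exists m.
(* Either the count has already risen by time [m], or it is still [k] and the value at [m.+1]
   triggers a crossing. *)
have := crossings_nondecreasing w _ _ nm.
rewrite -kE leq_eqVlt => /orP[/eqP kE'|]; last by exists m.
exists m.+1; rewrite crossings_prefixS -kE' /crossing_step.
by move: hm; case: (odd k) => ->; rewrite addn1.
Qed.

End Crossings.

(** Without a limit in [\bar R], the lower limit is strictly below the upper one and two rationals
    fit in between. They are returned as a level and a gap, to match [a] and [a + e]. *)
Lemma ereal_oscillation {R : realType} (u : nat -> \bar R) :
  (forall n, 0 <= u n) -> ~ cvgn u ->
  exists p q : rat, [/\ (0 <= p)%R, (0 < q)%R,
    forall n, exists2 m, (n < m)%N & u m <= (ratr p)%:E &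
    forall n, exists2 m, (n < m)%N & (ratr p + ratr q)%R%:E <= u m].
Proof.
move=> u0 ncvg.
have einf_esup : limn_einf u < limn_esup u.
  rewrite lt_neqAle limn_einf_sup andbT; apply/eqP => eq_lim; apply: ncvg.
  apply/cvg_ex; exists (limn_einf u).
  apply: (@squeeze_cvge _ _ _ _ (einfs u) u (esups u)).
  - apply: nearW => n; apply/andP; split.
      by apply: ereal_inf_lbound; exists n => /=.
    by apply: ereal_sup_ubound; exists n => /=.
  - by rewrite limn_einf_lim; exact: is_cvg_einfs.
  - by rewrite eq_lim limn_esup_lim; exact: is_cvg_esups.
have low (v : \bar R) : limn_einf u < v -> forall n, exists2 m, (n < m)%N & u m < v.
  move=> uv n; have : einfs u n.+1 < v.
    apply: le_lt_trans uv; rewrite limn_einf_lim (cvg_lim _ (@cvg_einfs_sup _ u))//.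
    by apply: ereal_sup_ubound; exists n.+1.
  by move=> /ereal_inf_lt[_ [m /= nm <-] umv]; exists m.
have high (v : \bar R) : v < limn_esup u -> forall n, exists2 m, (n < m)%N & v < u m.
  move=> uv n; have : v < esups u n.+1.
    apply: (lt_le_trans uv); rewrite limn_esup_lim (cvg_lim _ (@cvg_esups_inf _ u))//.
    by apply: ereal_inf_lbound; exists n.+1.
  by move=> /ereal_sup_gt[_ [m /= nm <-] umv]; exists m.
have inf0 : 0 <= limn_einf u.
  rewrite limn_einf_lim; apply: lime_ge; first exact: is_cvg_einfs.
  by apply: nearW => n; apply: le_ereal_inf_tmp => _ [m _ <-].
have [l [m [l0 lm ul mu]]] : exists l m : R,
    [/\ (0 <= l)%R, (l < m)%R, limn_einf u <= l%:E & m%:E <= limn_esup u].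
  have ufin : limn_einf u \is a fin_num.
    by rewrite ge0_fin_numE// (lt_le_trans einf_esup) ?leey.
  exists (fine (limn_einf u)).
  case: (limn_esup u) einf_esup => [m|_|]; last by rewrite ltNge leNye.
    by move=> um; exists m; split; rewrite ?fine_ge0// -?lte_fin ?fineK.
  (* When the upper limit is [+oo], any real above the lower limit serves as [m]. *)
  by exists (fine (limn_einf u) + 1)%R; split; rewrite ?fine_ge0 ?ltrDl ?fineK ?leey.
have [p /[!in_itv]/= /andP[lp pm]] := rat_in_itvoo lm.
have [q /[!in_itv]/= /andP[pq qm]] := rat_in_itvoo pm.
exists p, (q - p)%R; split.
- by rewrite -(ler0q R) (le_trans l0) ?ltW.
- by rewrite subr_gt0 -(ltr_rat R).
- move=> n; have [|k nk uk] := low (ratr p)%:E _ n.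
    by apply: le_lt_trans ul _; rewrite lte_fin.
  by exists k => //; exact: ltW.
- move=> n; have [|k nk uk] := high (ratr q)%:E _ n.
    by apply: lt_le_trans mu; rewrite lte_fin.
  by exists k => //; rewrite -rmorphD/= addrC subrK; exact: ltW.
Qed.

(** * A convergent process between [M] and a nearby supermartingale *)

Lemma convergent_envelope {R : realType} {X : Type}
    (Q : seq X -> (X -> \bar R) -> \bar R) (M : seq X -> \bar R) (s : seq X)
    (eps : R) :
  (forall t, upper_expectation (Q t)) -> supermartingale Q M ->
  (forall t, 0 <= M t) -> (0 < eps)%R ->
  exists G M' : seq X -> \bar R,
    [/\ supermartingale Q M', forall t, M t <= G t <= M' t,
        M' s <= M s + eps%:E & forall w, cvgn (fun n => G (path_prefix w n))].
Proof.
move=> Q_tree MQ M0 eps0.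
(* All pairs of rationals are enumerated; the default pair and the absolute values make every index
   a valid strategy. *)
pose ab i : rat * rat := odflt (0, 0)%R (unpickle i).
pose a i : R := `|ratr (ab i).1|%R; pose e i : R := `|ratr (ab i).2|%R.
have a0 i : (0 <= a i)%R by exact: normr_ge0.
have e0 i : (0 <= e i)%R by exact: normr_ge0.
pose K i := crossing_capital (a i) (e i) M.
have K0 i t : 0 <= K i t by exact: crossing_capital_ge0.
have fK0 i : (0 < 1 + fine (K i s))%R by rewrite ltr_wpDr// fine_ge0.
(* Makes [d i * K i s] at most [eps / 2 ^ i.+1]; the added 1 keeps the divisor positive. *)
pose d i : R := (eps / (2 ^ i.+1)%:R / (1 + fine (K i s)))%R.
have d0 i : (0 < d i)%R by rewrite !divr_gt0// ltr0n expn_gt0.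
have dK0 i t : 0 <= (d i)%:E * K i t by rewrite mule_ge0// lee_fin ltW.
pose U i t : \bar R := (d i * (e i *+ (crossings (a i) (e i) M t)./2))%:E.
have U0 i t : 0 <= U i t by rewrite lee_fin mulr_ge0 ?mulrn_wge0// ltW.
have UK i t : U i t <= (d i)%:E * K i t.
  by rewrite /U EFinM lee_wpmul2l ?crossing_capital_ge// lee_fin ltW.
pose S t := \sum_(i <oo) U i t.
have S0 t : 0 <= S t by apply: nneseries_ge0.
exists (fun t => M t + S t), (fun t => M t + \sum_(i <oo) (d i)%:E * K i t).
split.
- apply: supermartingaleD => //; first by move=> t; apply: nneseries_ge0.
  apply: supermartingale_nneseries => // i.
  exact: crossing_capital_supermartingale.
- move=> t; rewrite leeDl//= leeD2l//.
  by apply: lee_nneseries.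
- rewrite leeD2l//; apply: le_trans (epsilon_trick0 xpredT (ltW eps0)).
  apply: lee_nneseries => // i _.
  rewrite -[K i s]fineK ?crossing_capital_fin_num// -EFinM lee_fin /d.
  rewrite mulrAC ler_pdivrMr// ler_wpM2l// ?lerDr//.
  by rewrite divr_ge0 ?ltW.
- move=> w; pose u n := M (path_prefix w n).
  have S_nd : {homo (fun n => S (path_prefix w n)) : m n / (m <= n)%N >-> m <= n}.
    move=> m n mn; apply: lee_nneseries => // i _.
    rewrite lee_fin; apply: ler_wpM2l; first exact: ltW.
    apply: ler_wpMn2l => //; apply: half_leq.
    exact: crossings_nondecreasing.
  have S_cvg := ereal_nondecreasing_cvgn S_nd.
  have [/cvg_ex[l u_cvg]|ncvg] := pselect (cvgn u).
    apply/cvg_ex; eexists; apply: (cvgeD _ u_cvg S_cvg).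
    apply: ge0_adde_def; rewrite inE.
      by apply: cvge_ge u_cvg; apply: nearW => n; exact: M0.
    by apply: cvge_ge S_cvg; apply: nearW => n; exact: S0.
  (* Here [M] oscillates across the levels of one pair [i], and the single term [U i] drives [G] to
     [+oo]. *)
  have [p [q [p0 q0 low high]]] := ereal_oscillation u (fun n => M0 _) ncvg.
  pose i := pickle (p, q).
  have ai : a i = ratr p by rewrite /a /ab pickleK/= ger0_norm ?ler0q.
  have ei : e i = ratr q by rewrite /e /ab pickleK/= gtr0_norm ?ltr0q.
  apply/cvg_ex; exists +oo; apply/cvgeyPge => A.
  have dq0 : (0 < d i * ratr q)%R by rewrite mulr_gt0 ?ltr0q.
  (* After [k] upcrossings [U i] is at least [A]; each takes a purchase and a sale, hence [k.*2]
     below. *)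
  pose k := Num.bound `|A / (d i * ratr q)|%R.
  have [||m mk] := @crossings_unbounded R X (a i) (e i) M w _ _ k.*2.
  - by rewrite ai.
  - by rewrite ai ei.
  exists m => // n /= mn.
  apply: (@le_trans _ _ (S (path_prefix w n))); last by rewrite leeDr.
  apply: (@le_trans _ _ (U i (path_prefix w n))); last first.
    by rewrite /S (@nneseriesD1 _ _ i)// leeDl// nneseries_ge0.
  rewrite lee_fin ei mulrnAr -mulr_natl -ler_pdivrMr//.
  apply: (le_trans (ler_norm _)).
  apply: (le_trans (ltW (archi_boundP (normr_ge0 _)))).
  rewrite ler_nat geq_half_double; apply: leq_trans mk _; rewrite ei.
  exact: crossings_nondecreasing.
Qed.

(** * Approximation from above by limits of finitary variables *)

Lemma le_limn_einf {R : realType} (u v : nat -> \bar R) :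
  (forall n, u n <= v n) -> limn_einf u <= limn_einf v.
Proof.
move=> uv; rewrite !limn_einf_lim.
apply: lee_lim; [exact: is_cvg_einfs|exact: is_cvg_einfs|].
apply: nearW => n; apply: le_ereal_inf_tmp => _ [m nm <-].
by apply: le_trans (uv m); apply: ereal_inf_lbound; exists m.
Qed.

Lemma path_prefix_leq {X : Type} {w w' : nat -> X} {m n} : (m <= n)%N ->
  path_prefix w n = path_prefix w' n -> path_prefix w m = path_prefix w' m.
Proof.
move=> mn; have take_prefix v : path_prefix v m = take m (path_prefix v n).
  by rewrite /path_prefix /mkseq -map_take take_iota (minn_idPl mn).
by rewrite !take_prefix => ->.
Qed.

Lemma le_game_upper_expectation {R : realType} {X : Type}
    (Q : seq X -> (X -> \bar R) -> \bar R) (f g : (nat -> X) -> \bar R) s :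
  ge_at s g f -> game_upper_expectation Q f s <= game_upper_expectation Q g s.
Proof.
move=> fg; apply: ereal_inf_le_tmp => _ [M [MQ Mb Mg] <-]; exists M => //.
by split=> // w ws; apply: le_trans (fg w ws) (Mg w ws).
Qed.

Lemma lim_finitary_approx {R : realType} {X : eqType}
    (Q : seq X -> (X -> \bar R) -> \bar R) (f : (nat -> X) -> \bar R)
    (M : seq X -> \bar R) (s : seq X) (eps : R) :
  (forall t, upper_expectation (Q t)) -> supermartingale Q M ->
  bounded_below M -> ge_at s (liminf_path M) f -> (0 < eps)%R ->
  exists g, [/\ lim_finitary_bb g, forall w, f w <= g w &
    game_upper_expectation Q g s <= M s + eps%:E].
Proof.
move=> Q_tree MQ [c cM] Mf eps0.
have Mb : bounded_below M by exists c.
(* Subtracting the lower bound makes the process nonnegative; [c] is added back in [F]. *)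
pose N t := (- c)%:E + M t.
have NE t : c%:E + N t = M t by rewrite /N addeA -EFinD subrr add0e.
have N0 t : 0 <= N t by rewrite -(leeD2lE (x := c%:E))// NE adde0.
have [G [M' [M'Q NGM M's G_cvg]]] := convergent_envelope Q N s eps Q_tree
  (supermartingaleD_cst Q_tree (- c)%R M Mb MQ) N0 eps0.
have MG t : M t <= c%:E + G t.
  by rewrite -NE leeD2lE//; have /andP[] := NGM t.
have GM' t : c%:E + G t <= c%:E + M' t.
  by rewrite leeD2lE//; have /andP[] := NGM t.
(* The value [+oo] off the cylinder of [s] makes [g] dominate [f] on all paths, so the same [g]
   serves both infima. *)
pose F n w :=
  if path_prefix w (size s) == s then c%:E + G (path_prefix w n) else +oo.
have F_cvg w : cvgn (F ^~ w).
  rewrite /F; case: (_ == s); last exact: is_cvg_cst.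
  apply: is_cvgeD => //; last exact: is_cvg_cst.
  by rewrite lim_cst// fin_num_adde_defr.
exists (fun w => limn (F ^~ w)); split.
- split.
    exists c => w; apply: lime_ge => //; apply: nearW => n; rewrite /F.
    by case: ifP => _; [exact: le_trans (cM _) (MG _)|rewrite leey].
  exists F => [n|w]; last exact: F_cvg.
  exists (maxn n (size s)) => w w' ww'.
  rewrite /F (path_prefix_leq (leq_maxl _ _) ww').
  by rewrite (path_prefix_leq (leq_maxr _ _) ww').
- move=> w; rewrite -(is_cvg_limn_einfE (F_cvg w)) /F.
  case: (eqVneq (path_prefix w (size s)) s) => [ws|_].
    apply: le_trans (Mf w ws) _.
    by apply: le_limn_einf => n; exact: MG.
  by rewrite (cvg_limn_einf_sup (cvg_cst +oo)).1 leey.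
- apply: (@le_trans _ _ (c%:E + M' s)); last first.
    by rewrite -(NE s) -addeA leeD2lE.
  (* On the cylinder of [s] this process dominates every [F n], so its lower limit dominates [g]
     there. *)
  apply: ereal_inf_lbound; exists (fun t => c%:E + M' t) => //; split.
  + apply: supermartingaleD_cst => //.
    exists 0%R => t; have /andP[NG GMt] := NGM t.
    exact: le_trans (N0 t) (le_trans NG GMt).
  + by exists c => t; exact: le_trans (cM t) (le_trans (MG t) (GM' t)).
  + move=> w ws; rewrite -(is_cvg_limn_einfE (F_cvg w)) /F ws eqxx.
    by apply: le_limn_einf => n; exact: GM'.
Qed.

Theorem proposition28 (R : realType) (X : finType) (X_nonempty : (0 < #|X|)%N)
    (Q : seq X -> (X -> \bar R) -> \bar R) (Q_tree : imprecise_tree Q)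
    (f : (nat -> X) -> \bar R) (s : seq X) :
  game_upper_expectation Q f s =
    ereal_inf [set game_upper_expectation Q g s |
      g in [set g | lim_finitary_bb g /\ ge_at s g f]]
  /\
  ereal_inf [set game_upper_expectation Q g s |
      g in [set g | lim_finitary_bb g /\ ge_at s g f]] =
    ereal_inf [set game_upper_expectation Q g s |
      g in [set g | lim_finitary_bb g /\ forall w, f w <= g w]].
Proof.
set E := game_upper_expectation Q f s; set B := ereal_inf _; set C := ereal_inf _.
(* The cycle [E <= B <= C <= E] gives both equalities; only its last link needs the
   approximation. *)
have EB : E <= B.
  by apply: le_ereal_inf_tmp => _ [g [_ fg] <-]; exact: le_game_upper_expectation.
have BC : B <= C.
  by apply: ereal_inf_le_tmp => _ [g [gl fg] <-]; exists g => //; split=> // w _.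
have CE : C <= E.
  apply: le_ereal_inf_tmp => _ [M [MQ Mb Mf] <-].
  apply/lee_addgt0Pr => eps eps0.
  have [g [gl fg gM]] := lim_finitary_approx Q f M s eps Q_tree MQ Mb Mf eps0.
  by apply: le_trans gM; apply: ereal_inf_lbound; exists g.
by split; apply/eqP; rewrite eq_le; apply/andP; split=> //;
  [exact: le_trans CE|exact: le_trans EB].
Qed.
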